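(* The number of BM-special Triple O'Nan configurations on a non-classical orthogonal Buekenhout-Metz unital $\mathcal U_{a,b}$ in $\mathrm{PG}(2,q^2)$, $q$ odd, depends only on the value of $q$ and on whether $a$ is a square in $\mathbb F_{q^2}$ or not. That is, if $q$ is an odd prime power and $\mathcal U_{a,b}$, $\mathcal U_{a',b'}$ are two non-classical orthogonal Buekenhout-Metz unitals in $\mathrm{PG}(2,q^2)$ such that $a,a'$ are either both squares or both non-squares in $\mathbb F_{q^2}$, then $\mathcal U_{a,b}$ and $\mathcal U_{a',b'}$ contain the same number of BM-special Triple O'Nan configurations.
   Context: Points of $\mathrm{PG}(2,q^2)$ are written in homogeneous coordinates $(x,y,z)$. For $q$ odd and $a,b\in\mathbb F_{q^2}$ such that $d=(b-b^q)^2+4a^{q+1}$ is a non-square in $\mathbb F_q$, the orthogonal Buekenhout-Metz (BM) unital is $$\mathcal U_{a,b}=\{(x,ax^2+bx^{q+1}+r,1)\mid r\in\mathbb F_q,\ x\in\mathbb F_{q^2}\}\cup\{T_\infty=(0,1,0)\}.$$ It is classical if and only if $a=0$. The point $T_\infty$ is called the special point. A Triple O'Nan configuration of $\mathcal U$ is a set of six lines arising as follows: there is a quadrangle of four points of $\mathcal U$ (no three collinear) such that, for each of the three partitions of the four points into two pairs, the two lines joining the pairs meet in a point of $\mathcal U$; the six lines joining pairs of the four points form the Triple O'Nan. It is called BM-special if one of its six lines (as a line of $\mathrm{PG}(2,q^2)$) contains $T_\infty$. *)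

(* Defs.v *)
From HB Require Import structures.
From mathcomp Require Import all_boot all_order all_algebra all_field.

Set Implicit Arguments.
Unset Strict Implicit.
Unset Printing Implicit Defensive.

Import GRing.Theory.
Local Open Scope ring_scope.

(* F plays the role of the field with q ^ 2 elements. A subspace of F^3 is     *)
(* represented by the canonical matrix <<_>>%MS whose row space it is, so that *)
(* Leibniz equality of these matrices is equality of subspaces; points and     *)
(* lines of the plane are the subspaces of dimension 1 and 2, and incidence is *)
(* (P <= L)%MS.                                                                *)

Section BuekenhoutMetz.

Variables (F : finFieldType) (q : nat).

Implicit Types (P Q R A B C D : 'M[F]_3) (U : {set 'M[F]_3}).

Definition point (x y z : F) : 'M[F]_3 :=
  <<\row_(j < 3) [:: x; y; z]`_j>>%MS.

(* The inner %MS is needed: the argument of <<_>> is parsed in ring_scope. *)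
Definition line P Q : 'M[F]_3 := <<(P + Q)%MS>>%MS.

Definition meet (L M : 'M[F]_3) : 'M[F]_3 := <<L :&: M>>%MS.

(* For three points: they span F^3. In particular they are distinct. *)
Definition noncollinear P Q R : bool := \rank (P + Q + R)%MS == 3%N.

Definition quadrangle A B C D : bool :=
  [&& noncollinear A B C, noncollinear A B D,
      noncollinear A C D & noncollinear B C D].

(* The subfield with q elements, when #|F| = q ^ 2. *)
Definition Fq : {set F} := [set x | x ^+ q == x].

Definition square_in (K : {set F}) (x : F) : bool :=
  [exists y in K, x == y ^+ 2].

Definition nonsquare_in (K : {set F}) (x : F) : bool :=
  (x \in K) && ~~ square_in K x.

Definition bm_disc (a b : F) : F :=
  (b - b ^+ q) ^+ 2 + 4%:R * a ^+ q.+1.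

Definition T_infty : 'M[F]_3 := point 0 1 0.

Definition bm_unital (a b : F) : {set 'M[F]_3} :=
  [set point x (a * x ^+ 2 + b * x ^+ q.+1 + r) 1 | x in [set: F], r in Fq]
    :|: [set T_infty].

Definition conj_mx m n (A : 'M[F]_(m, n)) : 'M[F]_(m, n) :=
  map_mx (fun x => x ^+ q) A.

Definition hermitian_curve (H : 'M[F]_3) : {set 'M[F]_3} :=
  [set <<v>>%MS | v : 'rV[F]_3 & (v != 0) && (v *m H *m (conj_mx v)^T == 0)].

(* Classical unitals are the nondegenerate Hermitian curves, that is, the sets *)
(* of absolute points of the unitary polarities of the plane.                  *)
Definition classical U : Prop :=
  exists H : 'M[F]_3,
    [/\ H \in unitmx, H^T = conj_mx H & U = hermitian_curve H].

Definition six_lines A B C D : {set 'M[F]_3} :=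
  [set line A B; line C D; line A C; line B D; line A D; line B C].

Definition triple_onan U (S : {set 'M[F]_3}) : bool :=
  [exists A in U, exists B in U, exists C in U, exists D in U,
    [&& quadrangle A B C D,
        meet (line A B) (line C D) \in U,
        meet (line A C) (line B D) \in U,
        meet (line A D) (line B C) \in U
      & S == six_lines A B C D]].

Definition bm_special (S : {set 'M[F]_3}) : bool :=
  [exists L in S, (T_infty <= L)%MS].

Definition special_triple_onans U : {set {set 'M[F]_3}} :=
  [set S | triple_onan U S & bm_special S].

End BuekenhoutMetz.

(* Main.v *)
Require Import Defs.
From HB Require Import structures.
From mathcomp Require Import all_boot all_order all_algebra all_field.
From mathcomp Require Import all_fingroup all_solvable ring.

(* Write s for x |-> x ^+ q and im y = y - s y, so that the affine points of the
   unital are given by im y = Q(x) for an anisotropic quadratic form Q over Fq.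
   If three collinear points of the unital lie on distinct lines through
   T_infty, their x-coordinates are not collinear over Fq (on_unital_arc). This
   excludes T_infty as a vertex or a diagonal point of a Triple O'Nan, so that
   in a special one some line, say AB, is x = c and all seven points are affine.
   For a diagonal point off AB, 1 / (x - c) is an affine combination over Fq of
   its values at C and D; hence the x-coordinates of all seven points lie on a
   circle im (mu * x + nu) = kappa * x ^+ q.+1. Here kappa is arbitrary, and for
   the right one the collineation (x, y) |-> (t * x, y + mu * x + nu) maps the
   configuration into U_(a', b'), where a' = a / t ^+ 2. As mu and nu are
   determined by the configuration, and also by its image, this injects the
   special configurations of U_(a, b) into those of U_(a', b'). Two non-classical
   unitals of the same square type are related in this way in both directions,
   since a = 0 gives a Hermitian curve. *)

Set Implicit Arguments.
Unset Strict Implicit.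
Unset Printing Implicit Defensive.

Import GRing.Theory FinRing.Theory.
Local Open Scope ring_scope.

(** * Quadratic forms and circles over the fixed field of an involution *)

Definition det3 (R : nzRingType) (x1 y1 z1 x2 y2 z2 x3 y3 z3 : R) : R :=
  x1 * (y2 * z3 - y3 * z2) - y1 * (x2 * z3 - x3 * z2)
    + z1 * (x2 * y3 - x3 * y2).

Section InvolutionAlgebra.

Variables (K : fieldType) (s : {rmorphism K -> K}).
Hypotheses (sK : involutive s) (two_neq0 : 2%:R != 0 :> K).

Definition im (x : K) : K := x - s x.

Lemma imD x y : im (x + y) = im x + im y.
Proof. by rewrite /im rmorphD; ring. Qed.

Lemma im_fixed x : s x = x -> im x = 0.
Proof. by rewrite /im => ->; rewrite subrr. Qed.

Lemma im0_fixed x : im x = 0 -> s x = x.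
Proof. by move/eqP; rewrite subr_eq0 eq_sym => /eqP. Qed.

Lemma s_im x : s (im x) = - im x.
Proof. by rewrite /im rmorphB sK opprB. Qed.

Definition bmform (a b x : K) : K := im (a * x ^+ 2) + im b * (x * s x).

Definition anisotropic (a b : K) : Prop :=
  forall x, bmform a b x = 0 -> x = 0.

(** Put [N = x * s x], let [t] be the trace of [a * x ^+ 2] and d the discriminant. Then
    [t ^+ 2 - d * N ^+ 2] is the product of [bmform a b x] and [im (a * x ^+ 2) - im b * N], so a
    nontrivial zero of the form makes d the square of the fixed element [t / N]. *)
Lemma bmform_anisotropic a b :
    (forall r, s r = r -> (b - s b) ^+ 2 + 4%:R * (a * s a) != r ^+ 2) ->
  anisotropic a b.
Proof.
move=> dns x Qx0; apply/eqP/negPn/negP=> x_neq0.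
have sx_neq0 : s x != 0 by rewrite fmorph_eq0.
pose t := a * x ^+ 2 + s (a * x ^+ 2).
have st : s t = t by rewrite /t rmorphD sK addrC.
have sr : s (t / (x * s x)) = t / (x * s x).
  by rewrite fmorph_div st rmorphM sK [s x * x]mulrC.
case/negP: (dns _ sr); apply/eqP; rewrite expr_div_n.
have nx0 : (x * s x) ^+ 2 != 0 by rewrite expf_neq0 ?mulf_neq0.
apply: (mulIf nx0); rewrite divfK //; apply/eqP.
rewrite eq_sym -subr_eq0; apply/eqP.
transitivity ((im (a * x ^+ 2) - im b * (x * s x)) * bmform a b x).
  by rewrite /t /bmform /im !(rmorphXn, rmorphM) ?sK; ring.
by rewrite Qx0 mulr0.
Qed.

Definition on_unital (a b x y : K) : Prop := im y = bmform a b x.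

(** For [k] in the fixed field, the defect of the unital equation along the line is a quadratic
    polynomial in [k] with leading coefficient [bmform a b u], nonzero by anisotropy. Its roots 0
    and 1 leave no room for a third. *)
Lemma on_unital_collinear a b k x y u w :
    anisotropic a b -> s k = k -> u != 0 ->
    on_unital a b x y -> on_unital a b (x + u) (y + w) ->
    on_unital a b (x + k * u) (y + k * w) ->
  k = 0 \/ k = 1.
Proof.
move=> anis sk u_neq0 e1 e2 e3.
have /eqP : k * (k - 1) * bmform a b u = 0.
  transitivity ((bmform a b (x + k * u) - im (y + k * w))
     - k * (bmform a b (x + u) - im (y + w))
     + (k - 1) * (bmform a b x - im y)).
    rewrite /bmform /im !(rmorphD, rmorphM, rmorphXn) sk; ring.
  by rewrite e1 e2 e3 !subrr; ring.
rewrite !mulf_eq0 subr_eq0 => /orP[/orP[]/eqP-> | /eqP/anis/eqP]; auto.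
by rewrite (negPf u_neq0).
Qed.

(** When [s kappa = - kappa], both sides are negated by [s], so this is a single equation over the
    fixed field; for [kappa = 0] and [mu != 0] it is an affine line over that field. *)
Definition circle (kappa mu nu x : K) : Prop :=
  im (mu * x + nu) = kappa * (x * s x).

Lemma circle_through kappa c x1 x2 :
    s kappa = - kappa ->
    (x1 - c) * s (x2 - c) != (x2 - c) * s (x1 - c) ->
  exists mu nu, [/\ s nu = - nu, circle kappa mu nu c,
    circle kappa mu nu x1 & circle kappa mu nu x2].
Proof.
move=> skappa; rewrite -subr_eq0.
rewrite -[in X in _ -> X](subrKC c x1) -[in X in _ -> X](subrKC c x2).
move: (x1 - c) (x2 - c) => u v uv.
have uv' : s u * v - s v * u != 0 by rewrite -oppr_eq0 opprB mulrC [s u * _]mulrC.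
(* Cramer's rule for the two linear equations in [mu0] and [s mu0] that express the circle in
   coordinates centred at [c]. *)
have [mu0 def_mu0 smu0] : exists2 m,
    m = kappa * (s u * s v * (u - v)) / (u * s v - v * s u)
    & s m = kappa * (u * v * (s u - s v)) / (u * s v - v * s u).
  eexists; first by [].
  rewrite !(rmorphM, fmorphV, rmorphB, sK) skappa.
  by field; rewrite uv uv'.
(* The summand [kappa * s c] undoes the shift of origin. Since [im nu = 2 * nu], the condition at
   [c] then dictates [nu]. *)
have [mu def_mu] : exists mu, mu = mu0 + kappa * s c by eexists.
have [nu def_nu] : exists nu, nu = (kappa * (c * s c) - im (mu * c)) / 2%:R.
  by eexists.
have snu : s nu = - nu.
  rewrite def_nu fmorph_div rmorph_nat rmorphB s_im !rmorphM skappa sK.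
  by field; rewrite two_neq0.
exists mu, nu; rewrite /circle.
have cc : im (mu * c + nu) = kappa * (c * s c).
  rewrite imD {2}/im snu def_nu.
  by field; rewrite two_neq0.
split=> //.
- rewrite mulrDr -addrA [mu * u + nu]addrC addrA imD cc.
  rewrite def_mu /im !(rmorphM, rmorphD, sK) skappa smu0 def_mu0.
  by field; rewrite uv.
- rewrite mulrDr -addrA [mu * v + nu]addrC addrA imD cc.
  rewrite def_mu /im !(rmorphM, rmorphD, sK) skappa smu0 def_mu0.
  by field; rewrite uv.
Qed.

(* In the coordinate 1 / (x - c), the circles through c are the affine Fq-lines
   mu0 * s X - s mu0 * X = kappa. *)
Lemma circle_closed kappa mu nu c u v w p r :
    s kappa = - kappa -> s p = p -> s r = r -> r != 0 -> u != 0 -> v != 0 ->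
    w * (p * v + (r - p) * u) = u * v * r ->
    circle kappa mu nu c -> circle kappa mu nu (c + u) ->
    circle kappa mu nu (c + v) ->
  circle kappa mu nu (c + w).
Proof.
move=> skappa sp sr r0 u0 v0 def_w cc cu cv.
have wden0 : w * (p * v + (r - p) * u) != 0 by rewrite def_w !mulf_neq0.
have [w0 den0] : w != 0 /\ p * v + (r - p) * u != 0.
  by move: wden0; rewrite mulf_eq0 negb_or => /andP.
have [mu0 def_mu0] : exists mu0, mu0 = mu - kappa * s c by eexists.
have shift z : im (mu * (c + z) + nu) - kappa * ((c + z) * s (c + z))
   - (im (mu * c + nu) - kappa * (c * s c)) = im (mu0 * z) - kappa * (z * s z).
  rewrite def_mu0 /im !(mulrBl, rmorphD, rmorphN, rmorphM, sK) skappa; ring.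
have {}shift z : circle kappa mu nu (c + z) <-> im (mu0 * z) = kappa * (z * s z).
  have := shift z; rewrite /circle cc subrr subr0 => e.
  by split=> /eqP; rewrite -subr_eq0; [rewrite e | rewrite -e]; rewrite subr_eq0 => /eqP.
move/shift: cu; move/shift: cv => cv cu; apply/shift.
have inv z : z != 0 -> im (mu0 * z) = kappa * (z * s z) <->
    mu0 * s z^-1 - s mu0 * z^-1 = kappa.
  move=> z0; have sz0 : s z != 0 by rewrite fmorph_eq0.
  rewrite /im rmorphM fmorphV; split=> [e | <-].
    apply: (mulIf (mulf_neq0 z0 sz0)); rewrite -e.
    by field; rewrite z0 sz0.
  by field; rewrite z0 sz0.
move/(inv _ u0): cu; move/(inv _ v0): cv => cv cu; apply/(inv _ w0).
(* This is [def_w] divided by [u * v * w * r]. *)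
have -> : w^-1 = p / r * u^-1 + (1 - p / r) * v^-1.
  apply: (mulIf wden0).
  rewrite {2}def_w.
  by field; rewrite ?r0 ?u0 ?v0 ?w0.
have sk : s (p / r) = p / r by rewrite fmorph_div sp sr.
move: (p / r) sk => k sk.
rewrite !(rmorphD, rmorphN, rmorphM, rmorph1) sk.
transitivity (k * (mu0 * s u^-1 - s mu0 * u^-1)
             + (1 - k) * (mu0 * s v^-1 - s mu0 * v^-1)); first by ring.
by rewrite cu cv; ring.
Qed.

(** The difference of the two conditions is an affine functional over the fixed field that vanishes
    at three points not collinear over it, hence is zero. As [im] sees [nu] only modulo the fixed
    field, the normalisation [s nu = - nu] pins it down. *)
Lemma circle_unique kappa mu nu mu' nu' c x1 x2 :
    (x1 - c) * s (x2 - c) != (x2 - c) * s (x1 - c) ->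
    s nu = - nu -> s nu' = - nu' ->
    circle kappa mu nu c -> circle kappa mu' nu' c ->
    circle kappa mu nu x1 -> circle kappa mu' nu' x1 ->
    circle kappa mu nu x2 -> circle kappa mu' nu' x2 ->
  mu = mu' /\ nu = nu'.
Proof.
rewrite -subr_eq0 => x12 snu snu' c0 c0' c1 c1' c2 c2'.
have lin x : circle kappa mu nu x -> circle kappa mu' nu' x ->
    im ((mu - mu') * x + (nu - nu')) = 0.
  move=> e e'; transitivity (im (mu * x + nu) - im (mu' * x + nu')).
    by rewrite /im !(rmorphD, rmorphN, rmorphM); ring.
  by rewrite e e' subrr.
have e0 := lin _ c0 c0'; have e1 := lin _ c1 c1'; have e2 := lin _ c2 c2'.
have /eqP : (mu - mu') * ((x1 - c) * s (x2 - c) - (x2 - c) * s (x1 - c)) = 0.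
  transitivity ((im ((mu - mu') * x1 + (nu - nu'))
                 - im ((mu - mu') * c + (nu - nu'))) * s (x2 - c)
    - (im ((mu - mu') * x2 + (nu - nu'))
                 - im ((mu - mu') * c + (nu - nu'))) * s (x1 - c)).
    by rewrite /im !(rmorphD, rmorphN, rmorphM); ring.
  by rewrite e0 e1 e2 subrr !mul0r subrr.
rewrite mulf_eq0 (negPf x12) orbF => mu0.
split; first by apply/eqP; rewrite -subr_eq0.
have /eqP : 2%:R * (nu - nu') = 0.
  by rewrite -e0 (eqP mu0) mul0r add0r /im rmorphB snu snu'; ring.
by rewrite mulf_eq0 (negPf two_neq0) subr_eq0 => /eqP.
Qed.

(** * Collinear points of the unital and lines through the special point *)

Lemma on_unital_vertical a b c y y' :
  on_unital a b c y -> on_unital a b c y' -> s (y - y') = y - y'.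
Proof.
move=> e e'; apply: im0_fixed.
have -> : im (y - y') = im y - im y' by rewrite /im rmorphB; ring.
by rewrite e e' subrr.
Qed.

(** Equality would make the ratio of [x2 - c] to [x1 - c] fixed by [s]. This ratio is the parameter
    of the third point on the line through the first two, so [on_unital_collinear] forces it to be 0
    or 1 and two x-coordinates to coincide. *)
Lemma on_unital_arc a b c y x1 y1 x2 y2 :
    anisotropic a b -> on_unital a b c y -> on_unital a b x1 y1 ->
    on_unital a b x2 y2 -> det3 c y 1 x1 y1 1 x2 y2 1 = 0 ->
    x1 != c -> x2 != c -> x1 != x2 ->
  (x1 - c) * s (x2 - c) != (x2 - c) * s (x1 - c).
Proof.
move=> anis e0 e1 e2 col x1c x2c x12; apply/eqP => uv.
have u0 : x1 - c != 0 by rewrite subr_eq0.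
have su0 : s (x1 - c) != 0 by rewrite fmorph_eq0.
have sk : s ((x2 - c) / (x1 - c)) = (x2 - c) / (x1 - c).
  by apply/eqP; rewrite fmorph_div eqr_div // mulrC uv.
have [] := @on_unital_collinear a b ((x2 - c) / (x1 - c)) c y (x1 - c) (y1 - y).
- by [].
- by [].
- by [].
- by [].
- by rewrite !subrKC.
- rewrite divfK // subrKC (_ : _ / _ * _ = y2 - y) ?subrKC //.
  apply: (mulfI u0); rewrite mulrA [_ * (_ / _)]mulrC divfK //.
  by apply/eqP; rewrite -subr_eq0 -oppr_eq0 -{}col /det3; apply/eqP; ring.
- by apply/eqP; rewrite mulf_neq0 ?invr_eq0 ?subr_eq0.
- move/(congr1 (fun k => k * (x1 - c))); rewrite divfK // mul1r.
  by move/(can_inj (subrK c))/esym/eqP; rewrite (negPf x12).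
Qed.

(** Supplies the hypothesis [def_w] of [circle_closed]. On the line [x = c] lie two vertices, at
    heights [y1] and [y2], and a diagonal point at [y3]; the other vertices are [(x1, w1)] and
    [(x2, w2)], and [(x3, w3)] is a further diagonal point. A combination of the determinants
    eliminates every [w]. *)
Lemma collinear_vertices_circle (c y1 y2 y3 x1 w1 x2 w2 x3 w3 : K) :
    det3 c y3 1 x1 w1 1 x2 w2 1 = 0 -> det3 c y1 1 x1 w1 1 x3 w3 1 = 0 ->
    det3 c y2 1 x2 w2 1 x3 w3 1 = 0 ->
  (x3 - c) * ((y3 - y1) * (x2 - c) + ((y2 - y1) - (y3 - y1)) * (x1 - c))
    = (x1 - c) * (x2 - c) * (y2 - y1).
Proof.
move=> e1 e2 e3; apply/eqP; rewrite -subr_eq0; apply/eqP.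
transitivity ((x3 - c) * det3 c y3 1 x1 w1 1 x2 w2 1
  - (x2 - c) * det3 c y1 1 x1 w1 1 x3 w3 1
  + (x1 - c) * det3 c y2 1 x2 w2 1 x3 w3 1).
  by rewrite /det3; ring.
by rewrite e1 e2 e3 !mulr0 addr0 subr0.
Qed.

(** The case of [T_infty] as a vertex, with diagonal points [(x0, e)] and [(x1, g)]. The two
    collinearities give [(y1 - g) * (x2 - x0) = (e - y0) * (x2 - x1)], whose height differences are
    fixed by [s]; so the three x-coordinates are collinear over the fixed field, against
    [on_unital_arc]. *)
Lemma no_onan_special_vertex a b x0 y0 x1 y1 x2 y2 e g :
    anisotropic a b -> on_unital a b x0 y0 -> on_unital a b x1 y1 ->
    on_unital a b x2 y2 -> on_unital a b x0 e -> on_unital a b x1 g ->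
    x1 != x0 -> x2 != x0 -> x1 != x2 ->
    det3 x0 y0 1 x1 y1 1 x2 y2 1 != 0 ->
    det3 x0 e 1 x1 y1 1 x2 y2 1 = 0 -> det3 x1 g 1 x0 y0 1 x2 y2 1 = 0 ->
  False.
Proof.
move=> anis on0 on1 on2 onE onG x10 x20 x12 ncol colE colG.
have := on_unital_arc anis onE on1 on2 colE x10 x20 x12; case/eqP.
have se := on_unital_vertical onE on0; have sg := on_unital_vertical on1 onG.
have u0 : x2 - x0 != 0 by rewrite subr_eq0.
have e1 : (y1 - g) * (x2 - x0) = (e - y0) * (x2 - x1).
  apply/eqP; rewrite -subr_eq0; apply/eqP.
  transitivity (- (det3 x1 g 1 x0 y0 1 x2 y2 1 + det3 x0 e 1 x1 y1 1 x2 y2 1)).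
    by rewrite /det3; ring.
  by rewrite colE colG addr0 oppr0.
have e0 : e - y0 != 0.
  apply: contraNneq ncol => /eqP; rewrite subr_eq0 => /eqP <-.
  by rewrite colE.
have e2 := congr1 s e1; rewrite !(rmorphM s) se sg in e2.
have e3 : (x2 - x1) * s (x2 - x0) = s (x2 - x1) * (x2 - x0).
  by apply: (mulfI e0); rewrite !mulrA -e1 -e2; ring.
apply/eqP; rewrite -subr_eq0; apply/eqP.
transitivity (s (x2 - x1) * (x2 - x0) - (x2 - x1) * s (x2 - x0)).
  by rewrite !rmorphB; ring.
by rewrite e3 subrr.
Qed.

(** The case of [T_infty] as a diagonal point, the vertices lying in pairs on two vertical lines.
    Subtracting the collinearities shows that [x3 - c] is a fixed multiple of [x - c], again against
    [on_unital_arc]. *)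
Lemma no_onan_special_diagonal a b c y1 y2 x w1 w2 x3 w3 :
    anisotropic a b -> on_unital a b c y1 -> on_unital a b c y2 ->
    on_unital a b x w1 -> on_unital a b x w2 -> on_unital a b x3 w3 ->
    x != c -> y1 != y2 -> w1 != w2 ->
    det3 c y1 1 x w1 1 x3 w3 1 = 0 -> det3 c y2 1 x w2 1 x3 w3 1 = 0 ->
  False.
Proof.
move=> anis on1 on2 onC onD onG xc y12 w12 colAC colBD.
have sy := on_unital_vertical on2 on1; have sw := on_unital_vertical onC onD.
have e : (x3 - c) * (w1 - w2 + (y2 - y1)) = (x - c) * (y2 - y1).
  apply/eqP; rewrite -subr_eq0; apply/eqP.
  transitivity (det3 c y2 1 x w2 1 x3 w3 1 - det3 c y1 1 x w1 1 x3 w3 1).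
    by rewrite /det3; ring.
  by rewrite colAC colBD subrr.
have u0 : x - c != 0 by rewrite subr_eq0.
have r0 : y2 - y1 != 0 by rewrite subr_eq0 eq_sym.
have : (x3 - c) * (w1 - w2 + (y2 - y1)) != 0 by rewrite e mulf_neq0.
rewrite mulf_eq0 negb_or => /andP[x3c den0].
have x3x : x != x3.
  apply: contraNneq w12 => x3E; move/eqP: e.
  rewrite -x3E (inj_eq (mulfI u0)) -subr_eq0 addrK subr_eq0 //.
have := on_unital_arc anis on1 onC onG colAC xc _ x3x.
rewrite -(subr_eq0 x3) => /(_ x3c)/eqP; apply.
have sden : s (w1 - w2 + (y2 - y1)) = w1 - w2 + (y2 - y1).
  by rewrite rmorphD sw sy.
have e2 := congr1 s e; rewrite !(rmorphM s) sden sy in e2.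
apply: (mulIf den0); rewrite -mulrA e2 [RHS]mulrAC e.
ring.
Qed.

End InvolutionAlgebra.

(** * Finite fields *)

Lemma expr_pchar_rmorphism (R : comNzRingType) p k :
  p \in [pchar R] -> exists s : {rmorphism R -> R}, forall x, s x = x ^+ (p ^ k).
Proof.
move=> pcharR; elim: k => [|k [s IHs]].
  by exists (idfun : {rmorphism R -> R}) => x; rewrite expn0 expr1.
exists (pFrobenius_aut pcharR \o s : {rmorphism R -> R}) => x.
by rewrite /= IHs pFrobenius_autE expnSr exprM.
Qed.

(** As [q ^ 2] is a power of the characteristic, so is [q], and raising to the power [q] is an
    iterated Frobenius map. *)
Lemma finField_sqrt_rmorphism (F : finFieldType) q :
    #|F| = (q ^ 2)%N ->
  exists2 s : {rmorphism F -> F}, involutive s & forall x, s x = x ^+ q.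
Proof.
move=> cardF; have [p p_pr pcharF] := finPcharP F.
have /p_natP[k def_q] : p.-nat q.
  have /andP[pF _] := fin_ring_pchar_abelem pcharF.
  by move: pF; rewrite /pgroup cardsT cardF pnatX orbF.
have [s sE] := expr_pchar_rmorphism k pcharF; rewrite -def_q in sE.
exists s => // x; rewrite !sE -exprM mulnn -cardF.
exact: expf_card.
Qed.

Lemma finField_odd_two_neq0 (F : finFieldType) : odd #|F| -> 2%:R != 0 :> F.
Proof.
move=> oddF; apply/negP=> F2; have pchar2 : 2%N \in [pchar F] by rewrite inE F2.
have /andP[] := fin_ring_pchar_abelem pchar2.
rewrite /pgroup cardsT => /p_natP[[|k] cardF _].
  by have := finNzRing_gt1 F; rewrite cardF.
by move: oddF; rewrite cardF oddX.
Qed.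

(** It suffices that [a * b] is a square [d ^+ 2], with [c = d / a]. Two non-squares have odd
    logarithms to a generator of the cyclic unit group, and the sum of these is even. *)
Lemma square_quotient (F : finFieldType) (a b : F) :
    square_in [set: F] a = square_in [set: F] b -> a != 0 -> b != 0 ->
  exists2 c, c != 0 & b = a * c ^+ 2.
Proof.
move=> ab a0 b0.
suff [d ab_d] : exists d, a * b = d ^+ 2.
  have d0 : d != 0 by apply: contraNneq (mulf_neq0 a0 b0) => d0; rewrite ab_d d0 expr0n.
  exists (d / a); first by rewrite mulf_neq0 ?invr_eq0.
  by rewrite expr_div_n -ab_d; field.
move: ab; rewrite /square_in; case: exists_inP => [[u _ /eqP->]|not_sq_a].
  by move/esym/exists_inP=> [v _ /eqP->]; exists (u * v); rewrite exprMn.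
move/esym/exists_inP=> not_sq_b.
have /cyclicP[g def_g] := field_unit_group_cyclic [set: {unit F}]%G.
have odd_log x : x != 0 -> ~ (exists2 y, y \in [set: F] & x == y ^+ 2) ->
    exists k, x = val g ^+ k.*2.+1.
  move=> x0 nsq; have: finField_unit x0 \in <[g]>%g by rewrite -def_g inE.
  case/cycleP=> n def_x; have {}def_x : x = val g ^+ n.
    by rewrite -val_unitX -def_x.
  exists n./2; rewrite def_x -[in LHS](odd_double_half n).
  case: (boolP (odd n)) => // even_n; case: nsq.
  exists (val g ^+ n./2); rewrite ?inE // -exprM muln2 def_x; apply/eqP/congr1.
  by rewrite -[LHS](odd_double_half n) (negPf even_n).
have [i ->] := odd_log _ a0 not_sq_a; have [j ->] := odd_log _ b0 not_sq_b.
exists (val g ^+ (i + j).+1); rewrite -exprD -exprM muln2; congr (_ ^+ _).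
by rewrite addSn addnS doubleS doubleD.
Qed.

(** * Points and lines *)

Lemma forall_ord3 (P : 'I_3 -> Prop) :
  P 0 -> P 1 -> P 2%:R -> forall i, P i.
Proof.
move=> P0 P1 P2 [[|[|[|//]]] lt_i3].
- by rewrite (_ : Ordinal lt_i3 = 0) //; apply: val_inj.
- by rewrite (_ : Ordinal lt_i3 = 1) //; apply: val_inj.
- by rewrite (_ : Ordinal lt_i3 = 2%:R) //; apply: val_inj.
Qed.

Section Plane.

Variable F : finFieldType.
Implicit Types (x y z : F) (P Q R A B C D L : 'M[F]_3).

Definition vec x y z : 'rV[F]_3 := \row_(j < 3) [:: x; y; z]`_j.

Lemma rowE_vec (v : 'rV[F]_3) : v = vec (v 0 0) (v 0 1) (v 0 2%:R).
Proof. by apply/rowP; apply: forall_ord3; rewrite !mxE. Qed.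

Lemma vec_mul x y z (M : 'M[F]_3) :
  vec x y z *m M = x *: row 0 M + y *: row 1 M + z *: row 2%:R M.
Proof.
apply/rowP=> j; rewrite !mxE !big_ord_recl big_ord0 /= addr0 !mxE /= addrA.
by congr (_ + _ * M _ _ + _ * M _ _); apply: val_inj.
Qed.

Lemma det_mx33 (M : 'M[F]_3) :
  \det M = det3 (M 0 0) (M 0 1) (M 0 2%:R) (M 1 0) (M 1 1) (M 1 2%:R)
                (M 2%:R 0) (M 2%:R 1) (M 2%:R 2%:R).
Proof.
(* Entries indexed by naturals let the lifted ordinals of the cofactor expansion compute. *)
have [m ME] : exists m : nat -> nat -> F, forall i j, M i j = m i j.
  by exists (fun i j => M (inord i) (inord j)) => i j; rewrite !inord_val.
rewrite (expand_det_row _ 0) !big_ord_recl big_ord0 /cofactor.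
rewrite !(expand_det_row _ 0) !big_ord_recl !big_ord0 /cofactor !det_mx11 !mxE.
rewrite /det3 !ME /= /bump /=.
by ring.
Qed.

Lemma noncollinear_point x1 y1 z1 x2 y2 z2 x3 y3 z3 :
  noncollinear (point x1 y1 z1) (point x2 y2 z2) (point x3 y3 z3)
    = (det3 x1 y1 z1 x2 y2 z2 x3 y3 z3 != 0).
Proof.
pose M : 'M[F]_3 :=
  \matrix_i [:: vec x1 y1 z1; vec x2 y2 z2; vec x3 y3 z3]`_i.
have -> : det3 x1 y1 z1 x2 y2 z2 x3 y3 z3 = \det M.
  by rewrite det_mx33 !mxE.
rewrite -unitfE -unitmxE -row_free_unit /row_free /noncollinear.
congr (_ == _); apply: eqmx_rank; apply/andP; split.
  rewrite !addsmx_sub !genmxE.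
  have MS i := row_sub i M; have := MS 0; have := MS 1; have := MS 2%:R.
  by rewrite !rowK /= => -> -> ->.
apply/row_subP; apply: forall_ord3; rewrite rowK /= /point.
- by rewrite (submx_trans _ (addsmxSl _ _)) // (submx_trans _ (addsmxSl _ _)) ?genmxE.
- by rewrite (submx_trans _ (addsmxSl _ _)) // (submx_trans _ (addsmxSr _ _)) ?genmxE.
- by rewrite (submx_trans _ (addsmxSr _ _)) ?genmxE.
Qed.

Lemma point_affine_inj x y x' y' :
  point x y 1 = point x' y' 1 -> x = x' /\ y = y'.
Proof.
move/genmxP/andP=> [/sub_rVP[k /rowP kv] _].
have:= kv 2%:R; rewrite !mxE /= mulr1 => k1.
by have:= kv 0; have:= kv 1; rewrite !mxE /= -k1 !mul1r.
Qed.

Lemma point_affine_neq_T x y : point x y 1 <> T_infty F.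
Proof.
move/genmxP/andP=> [/sub_rVP[k /rowP kv] _].
by have/eqP:= kv 2%:R; rewrite !mxE /= mulr0 oner_eq0.
Qed.

Lemma mxrank_point x y z : (\rank (point x y z) <= 1)%N.
Proof. by rewrite genmxE rank_leq_row. Qed.

Lemma mxrank_line_point P Q : (\rank P <= 1)%N -> (\rank Q <= 1)%N ->
  (\rank (line P Q) <= 2)%N.
Proof.
move=> rP rQ; rewrite genmxE; apply: leq_trans (mxrank_adds_leqif _ _) _.
by rewrite (leq_add rP rQ).
Qed.

Lemma collinear_on P Q R L :
    (\rank L <= 2)%N -> (P <= L)%MS -> (Q <= L)%MS -> (R <= L)%MS ->
  ~~ noncollinear P Q R.
Proof.
move=> rL PL QL RL; rewrite /noncollinear.
have /mxrankS : (P + Q + R <= L)%MS by rewrite !addsmx_sub PL QL RL.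
by move/leq_trans/(_ rL); case: eqP => // ->.
Qed.

Lemma lineC P Q : line P Q = line Q P.
Proof. by rewrite /line addsmxC. Qed.

Lemma meetC L M : meet L M = meet M L.
Proof. by rewrite /meet capmxC. Qed.

Lemma line_left P Q : (P <= line P Q)%MS.
Proof. by rewrite genmxE addsmxSl. Qed.

Lemma line_right P Q : (Q <= line P Q)%MS.
Proof. by rewrite genmxE addsmxSr. Qed.

Lemma meet_left L M : (meet L M <= L)%MS.
Proof. by rewrite genmxE capmxSl. Qed.

Lemma meet_right L M : (meet L M <= M)%MS.
Proof. by rewrite genmxE capmxSr. Qed.

Lemma noncollinearC12 P Q R : noncollinear P Q R = noncollinear Q P R.
Proof. by rewrite /noncollinear [(P + Q)%MS]addsmxC. Qed.

Lemma noncollinearC23 P Q R : noncollinear P Q R = noncollinear P R Q.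
Proof. by rewrite /noncollinear -!addsmxA [(Q + R)%MS]addsmxC. Qed.

Lemma line_id P Q : <<line P Q>>%MS = line P Q.
Proof. exact: genmx_id. Qed.

Lemma point_id x y z : <<point x y z>>%MS = point x y z.
Proof. exact: genmx_id. Qed.

Lemma mxrank_affine_point x y : \rank (point x y 1) = 1%N.
Proof.
rewrite genmxE rank_rV; case: eqP => // /rowP/(_ 2%:R).
by rewrite !mxE /= => /eqP; rewrite oner_eq0.
Qed.

Lemma mxrank_T : \rank (T_infty F) = 1%N.
Proof.
rewrite genmxE rank_rV; case: eqP => // /rowP/(_ 1).
by rewrite !mxE /= => /eqP; rewrite oner_eq0.
Qed.

(** An intersection of rank 2 would equal both lines, so it has rank at most 1 and both points
    coincide with it. *)
Lemma lines_meet_unique P Q L M :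
    <<P>>%MS = P -> <<Q>>%MS = Q -> <<L>>%MS = L -> <<M>>%MS = M ->
    \rank P = 1%N -> \rank Q = 1%N ->
    (\rank L <= 2)%N -> (\rank M <= 2)%N -> L != M ->
    (P <= L)%MS -> (P <= M)%MS -> (Q <= L)%MS -> (Q <= M)%MS ->
  P = Q.
Proof.
move=> P1 Q1 L1 M1 rP rQ rL rM LM PL PM QL QM.
have cap1 : (\rank (L :&: M) <= 1)%N.
  rewrite leqNgt; apply: contra LM => cap2.
  have LcapM : (L <= L :&: M)%MS.
    by rewrite -(geq_leqif (mxrank_leqif_sup (capmxSl L M))) (leq_trans rL).
  have McapL : (M <= L :&: M)%MS.
    by rewrite -(geq_leqif (mxrank_leqif_sup (capmxSr L M))) (leq_trans rM).
  rewrite -L1 -M1; apply/eqP/genmxP.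
  by rewrite (submx_trans LcapM (capmxSr L M)) (submx_trans McapL (capmxSl L M)).
have capE R : <<R>>%MS = R -> \rank R = 1%N -> (R <= L)%MS -> (R <= M)%MS ->
    R = <<L :&: M>>%MS.
  move=> R1 rR RL RM; rewrite -[LHS]R1; apply/genmxP.
  have RLM : (R <= L :&: M)%MS by rewrite sub_capmx RL.
  by rewrite RLM -(geq_leqif (mxrank_leqif_sup RLM)) rR.
by rewrite (capE P) // -(capE Q).
Qed.

Lemma noncollinear_neq P Q R : (\rank P <= 1)%N -> (\rank R <= 1)%N ->
  noncollinear P Q R -> P != Q.
Proof.
move=> rP rR; apply: contraTneq => <-.
by apply: (@collinear_on _ _ _ (line P R));
  rewrite ?line_left ?line_right ?mxrank_line_point.
Qed.

Lemma noncollinear_line_neq P Q R :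
    (\rank P <= 1)%N -> (\rank Q <= 1)%N -> (\rank R <= 1)%N ->
  noncollinear P Q R -> line P Q != line P R.
Proof.
move=> rP rQ rR; apply: contraTneq => PQR.
by apply: (@collinear_on _ _ _ (line P Q));
  rewrite ?line_left ?line_right ?mxrank_line_point // PQR line_right.
Qed.

End Plane.

(** * O'Nan configurations *)

Section Onan.

Variable F : finFieldType.
Implicit Types (x y z : F) (P Q R A B C D L : 'M[F]_3) (U : {set 'M[F]_3}).

Local Notation T := (T_infty F).

Lemma point_on_line_det3 x1 y1 z1 x2 y2 z2 x3 y3 z3 :
    (point x3 y3 z3 <= line (point x1 y1 z1) (point x2 y2 z2))%MS ->
  det3 x1 y1 z1 x2 y2 z2 x3 y3 z3 = 0.
Proof.
move=> on; apply/eqP; rewrite -[_ == 0]negbK -noncollinear_point.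
by apply: (@collinear_on _ _ _ _ (line (point x1 y1 z1) (point x2 y2 z2)));
  rewrite ?mxrank_line_point ?mxrank_point ?line_left ?line_right.
Qed.

Lemma T_on_line x1 y1 x2 y2 :
  (T <= line (point x1 y1 1) (point x2 y2 1))%MS -> x1 = x2.
Proof.
move/point_on_line_det3 => e; apply/eqP; rewrite -subr_eq0 -oppr_eq0 -e.
by rewrite /det3; apply/eqP; ring.
Qed.

Lemma on_line_T x y x' y' :
  (point x' y' 1 <= line T (point x y 1))%MS -> x' = x.
Proof.
move/point_on_line_det3 => e; apply/eqP; rewrite -subr_eq0 -e.
by rewrite /det3; apply/eqP; ring.
Qed.

Lemma noncollinear_T x1 y1 x2 y2 :
  noncollinear T (point x1 y1 1) (point x2 y2 1) = (x1 != x2).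
Proof.
rewrite noncollinear_point [in RHS]eq_sym -[in RHS]subr_eq0.
by congr (_ != 0); rewrite /det3; ring.
Qed.

Lemma noncollinear_affine x1 y1 x2 y2 x3 y3 :
  noncollinear (point x1 y1 1) (point x2 y2 1) (point x3 y3 1) =
    ((x2 - x1) * (y3 - y1) != (x3 - x1) * (y2 - y1)).
Proof.
rewrite noncollinear_point -[in RHS]subr_eq0.
by congr (_ != 0); rewrite /det3; ring.
Qed.

(** A labelled Triple O'Nan. The three adjacent swaps proved below generate all relabellings of the
    quadrangle. *)
Definition onan U A B C D : bool :=
  [&& A \in U, B \in U, C \in U, D \in U, quadrangle A B C D,
      meet (line A B) (line C D) \in U,
      meet (line A C) (line B D) \in U
    & meet (line A D) (line B C) \in U].

Lemma triple_onanP U S :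
  reflect (exists A B C D, onan U A B C D /\ S = six_lines A B C D)
          (triple_onan U S).
Proof.
apply: (iffP exists_inP).
  case=> A UA /exists_inP[B UB /exists_inP[C UC /exists_inP[D UD]]].
  case/and5P=> qABCD UE UG UH /eqP->; exists A, B, C, D; split=> //.
  by rewrite /onan UA UB UC UD qABCD UE UG.
case=> A [B [C [D [/and5P[UA UB UC UD /and4P[qABCD UE UG UH]] ->]]]].
exists A => //; apply/exists_inP; exists B => //; apply/exists_inP; exists C => //.
apply/exists_inP; exists D => //.
by rewrite qABCD UE UG UH eqxx.
Qed.

Lemma onan_swap12 U A B C D : onan U A B C D -> onan U B A C D.
Proof.
case/and5P=> UA UB UC UD /and4P[/and4P[n1 n2 n3 n4] UE UG UH].
rewrite /onan /quadrangle UA UB UC UD !(noncollinearC12 B A) n1 n2 n3 n4.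
by rewrite (lineC B A) UE meetC UH meetC UG.
Qed.

Lemma onan_swap34 U A B C D : onan U A B C D -> onan U A B D C.
Proof.
case/and5P=> UA UB UC UD /and4P[/and4P[n1 n2 n3 n4] UE UG UH].
rewrite /onan /quadrangle UA UB UC UD !(noncollinearC23 _ D C) n1 n2 n3 n4.
by rewrite (lineC D C) UE UH UG.
Qed.

Lemma onan_swap23 U A B C D : onan U A B C D -> onan U A C B D.
Proof.
case/and5P=> UA UB UC UD /and4P[/and4P[n1 n2 n3 n4] UE UG UH].
rewrite /onan /quadrangle UA UB UC UD (noncollinearC23 A C B) n1 n2 n3.
by rewrite (noncollinearC12 C B) n4 UG UE (lineC C B) UH.
Qed.

Lemma six_lines_swap12 A B C D : six_lines A B C D = six_lines B A C D.
Proof.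
rewrite /six_lines (lineC B A); apply/setP => L; rewrite !inE.
by do 6! case: eqP => ?.
Qed.

Lemma six_lines_swap34 A B C D : six_lines A B C D = six_lines A B D C.
Proof.
rewrite /six_lines (lineC D C); apply/setP => L; rewrite !inE.
by do 6! case: eqP => ?.
Qed.

Lemma six_lines_swap23 A B C D : six_lines A B C D = six_lines A C B D.
Proof.
rewrite /six_lines (lineC C B); apply/setP => L; rewrite !inE.
by do 6! case: eqP => ?.
Qed.

(** Whichever of the six lines contains [T_infty], a relabelling of the vertices turns it into
    [A B]. *)
Lemma special_triple_onanP U S :
    S \in special_triple_onans U ->
  exists A B C D, [/\ onan U A B C D, S = six_lines A B C D
                    & (T <= line A B)%MS].
Proof.
rewrite inE => /andP[/triple_onanP[A [B [C [D [oU ->]]]]]].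
have r23 A' B' C' D' := @onan_swap23 U A' B' C' D'.
have r12 A' B' C' D' := @onan_swap12 U A' B' C' D'.
have r34 A' B' C' D' := @onan_swap34 U A' B' C' D'.
case/exists_inP=> L; rewrite !inE -!orbA => LS TL.
have {LS}: [\/ L = line A B, L = line A C, L = line A D | L = line B C] \/
    (L = line B D \/ L = line C D).
  by case/or4P: LS => [|||/or3P[]] /eqP->;
    [left | right; right | left | right; left | left | left]; auto; constructor.
case=> [[]|[]] LE; rewrite {}LE in TL.
- by exists A, B, C, D.
- by exists A, C, B, D; rewrite six_lines_swap23; split; auto.
- by exists A, D, B, C; rewrite six_lines_swap34 six_lines_swap23; split; auto.
- exists B, C, A, D; rewrite six_lines_swap12 six_lines_swap23; split; auto.
- exists B, D, A, C; rewrite six_lines_swap12 six_lines_swap34 six_lines_swap23.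
  by split; auto.
- exists C, D, A, B; rewrite six_lines_swap23 six_lines_swap12 six_lines_swap34.
  by rewrite six_lines_swap23; split; auto 6.
Qed.

Definition onan_points A B C D : seq 'M[F]_3 :=
  [:: A; B; C; D; meet (line A B) (line C D);
      meet (line A C) (line B D); meet (line A D) (line B C)].

Lemma forall_onan_points A B C D (Z : 'M[F]_3 -> Prop) :
    (forall P, P \in onan_points A B C D -> Z P) ->
  [/\ Z A, Z B, Z C & Z D] /\
  [/\ Z (meet (line A B) (line C D)), Z (meet (line A C) (line B D))
    & Z (meet (line A D) (line B C))].
Proof.
rewrite /onan_points; move: (meet _ _) (meet _ _) (meet _ _) => H G E ZP.
by do !split; apply: ZP; rewrite !inE eqxx ?orbT.
Qed.

Lemma onan_points_sub U A B C D P :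
  onan U A B C D -> P \in onan_points A B C D -> P \in U.
Proof.
case/and5P=> UA UB UC UD /and4P[_ UE UG UH].
rewrite /onan_points; move: (meet _ _) (meet _ _) (meet _ _) UE UG UH.
by move=> H G E UE UG UH; rewrite !inE => /or4P[|||/or4P[]] /eqP->.
Qed.

End Onan.

(** * Special configurations on a unital *)

Section Unital.

Variables (F : finFieldType) (q : nat) (s : {rmorphism F -> F}).
Hypotheses (sK : involutive s) (sE : forall x, s x = x ^+ q).
Hypothesis two_neq0 : 2%:R != 0 :> F.
Implicit Types (x y z : F) (P Q R A B C D L : 'M[F]_3) (U : {set 'M[F]_3}).

Local Notation T := (T_infty F).

(** Since [x * s x] is fixed by [s], applying [im] to the parametrisation removes exactly the
    parameter [r] of the subfield. *)
Lemma bm_unitalP a b P :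
  reflect (P = T \/ exists x y, P = point x y 1 /\ on_unital s a b x y)
          (P \in bm_unital q a b).
Proof.
have norm x : b * x ^+ q.+1 = b * (x * s x) by rewrite exprS sE.
have imQ x : im s (a * x ^+ 2 + b * x ^+ q.+1) = bmform s a b x.
  rewrite norm /bmform /im rmorphD (rmorphM s b) (rmorphM s x) sK.
  by rewrite [s x * x]mulrC; ring.
rewrite !inE; apply: (iffP orP) => [[/imset2P[x r _]|/eqP->]|[->|]].
- rewrite inE -sE => /eqP sr ->; right; do 2 eexists; split=> //.
  by rewrite /on_unital imD imQ (im_fixed sr) addr0.
- by left.
- by right.
- case=> x [y [-> onP]]; left; apply/imset2P.
  exists x (y - (a * x ^+ 2 + b * x ^+ q.+1)); rewrite ?subrKC ?inE // -sE.
  apply/eqP/im0_fixed.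
  have -> : im s (y - (a * x ^+ 2 + b * x ^+ q.+1)) =
      im s y - im s (a * x ^+ 2 + b * x ^+ q.+1) by rewrite /im rmorphB; ring.
  by rewrite imQ onP subrr.
Qed.

Lemma affine_in_unital a b x y :
  (point x y 1 \in bm_unital q a b) <-> on_unital s a b x y.
Proof.
split=> [/bm_unitalP[/point_affine_neq_T // | [x' [y']]] | onP].
  by case=> /point_affine_inj[-> ->].
by apply/bm_unitalP; right; exists x, y.
Qed.

Lemma nonsquare_disc_anisotropic a b :
  nonsquare_in (Fq F q) (bm_disc q a b) -> anisotropic s a b.
Proof.
case/andP=> _ ns; apply: (bmform_anisotropic sK) => r sr.
apply: contra ns => /eqP d_r; apply/exists_inP.
exists r; first by rewrite inE -sE sr.
by rewrite -d_r /bm_disc !sE [a ^+ q.+1]exprS.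
Qed.

Section Config.

Variables a b : F.
Hypothesis anis : anisotropic s a b.
Local Notation U := (bm_unital q a b).

Lemma mxrank_unital P : P \in U -> \rank P = 1%N.
Proof.
by case/bm_unitalP=> [->|[x [y [-> _]]]]; rewrite ?mxrank_T ?mxrank_affine_point.
Qed.

Lemma unital_affine P : P \in U -> P != T ->
  exists x y, P = point x y 1 /\ on_unital s a b x y.
Proof. by case/bm_unitalP=> [-> /eqP|]. Qed.

Lemma genmx_unital P : P \in U -> <<P>>%MS = P.
Proof. by case/bm_unitalP=> [->|[x [y [-> _]]]]; rewrite point_id. Qed.

Lemma onan_neq A B C D : onan U A B C D -> A != B.
Proof.
case/and5P=> UA UB UC UD /and4P[/and4P[n1 _ _ _] _ _ _].
by apply: noncollinear_neq n1; rewrite mxrank_unital.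
Qed.

(** With [A = T_infty], the lines [A B] and [A C] are vertical, and the diagonal points on them
    contradict [no_onan_special_vertex]. Relabelling extends this to every vertex. *)
Lemma onan_vertex_neq_T A B C D : onan U A B C D -> A != T.
Proof.
move=> oU; apply/eqP => AT; rewrite {A}AT in oU.
have BT : B != T by rewrite eq_sym (onan_neq oU).
have CT : C != T by rewrite eq_sym (onan_neq (onan_swap23 oU)).
have DT : D != T by rewrite eq_sym (onan_neq (onan_swap23 (onan_swap34 oU))).
case/and5P: oU => _ UB UC UD /and4P[/and4P[n1 n2 n3 n4] UE UG _].
have [x0 [y0 [EB on0]]] := unital_affine UB BT.
have [x1 [y1 [EC on1]]] := unital_affine UC CT.
have [x2 [y2 [ED on2]]] := unital_affine UD DT.
subst B C D; rewrite !noncollinear_T in n1 n2 n3.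
(* A diagonal point at [T_infty] would make [C] and [D] collinear with the vertex [T_infty]. *)
have ET : meet (line T (point x0 y0 1)) (line (point x1 y1 1) (point x2 y2 1)) != T.
  apply: contraNneq n3 => ET; apply/eqP/T_on_line; rewrite -{1}ET.
  exact: meet_right.
have GT : meet (line T (point x1 y1 1)) (line (point x0 y0 1) (point x2 y2 1)) != T.
  apply: contraNneq n2 => GT; apply/eqP/T_on_line; rewrite -{1}GT.
  exact: meet_right.
have [xe [e [EE onE]]] := unital_affine UE ET.
have [xg [g [EG onG]]] := unital_affine UG GT.
have := meet_left (line T (point x0 y0 1)) (line (point x1 y1 1) (point x2 y2 1)).
have := meet_right (line T (point x0 y0 1)) (line (point x1 y1 1) (point x2 y2 1)).
rewrite EE => colE /on_line_T xe0; subst xe.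
have := meet_left (line T (point x1 y1 1)) (line (point x0 y0 1) (point x2 y2 1)).
have := meet_right (line T (point x1 y1 1)) (line (point x0 y0 1) (point x2 y2 1)).
rewrite EG => colG /on_line_T xg1; subst xg.
apply: (no_onan_special_vertex anis on0 on1 on2 onE onG).
- by rewrite eq_sym.
- by rewrite eq_sym.
- by [].
- by rewrite -noncollinear_point.
- by rewrite -(point_on_line_det3 colE) /det3; ring.
- by rewrite -(point_on_line_det3 colG) /det3; ring.
Qed.

(** Otherwise [A B] and [C D] are distinct vertical lines, and the diagonal point of [A C] and [B D]
    contradicts [no_onan_special_diagonal]. *)
Lemma onan_diagonal_neq_T A B C D :
  onan U A B C D -> meet (line A B) (line C D) != T.
Proof.
move=> oU; apply/eqP => ET.
have AT := onan_vertex_neq_T oU.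
have BT := onan_vertex_neq_T (onan_swap12 oU).
have CT := onan_vertex_neq_T (onan_swap12 (onan_swap23 oU)).
have DT := onan_vertex_neq_T (onan_swap12 (onan_swap23 (onan_swap34 oU))).
case/and5P: oU => UA UB UC UD /and4P[/and4P[n1 n2 n3 n4] UE UG _].
have [c [y1 [EA on0]]] := unital_affine UA AT.
have [x0 [y2 [EB on1]]] := unital_affine UB BT.
have [x [w1 [EC on2]]] := unital_affine UC CT.
have [x' [w2 [ED on3]]] := unital_affine UD DT.
subst A B C D.
have := meet_left (line (point c y1 1) (point x0 y2 1))
                  (line (point x w1 1) (point x' w2 1)).
have := meet_right (line (point c y1 1) (point x0 y2 1))
                  (line (point x w1 1) (point x' w2 1)).
rewrite ET => /T_on_line/esym xx' /T_on_line/esym cx0; subst x' x0.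
rewrite !noncollinear_affine !subrr !mul0r in n1 n3.
rewrite eq_sym mulf_eq0 negb_or !subr_eq0 in n1.
case/andP: n1 => xc y12.
have w12 : w1 != w2 by apply: contraNneq n3 => ->.
have GT : meet (line (point c y1 1) (point x w1 1))
               (line (point c y2 1) (point x w2 1)) != T.
  apply: contraNneq xc => GT; apply/eqP/esym/T_on_line; rewrite -{1}GT.
  exact: meet_left.
have [x3 [w3 [EG onG]]] := unital_affine UG GT.
have := meet_left (line (point c y1 1) (point x w1 1))
                  (line (point c y2 1) (point x w2 1)).
have := meet_right (line (point c y1 1) (point x w1 1))
                  (line (point c y2 1) (point x w2 1)).
rewrite EG => /point_on_line_det3 colB /point_on_line_det3 colA.
apply: (no_onan_special_diagonal anis on0 on1 on2 on3 onG xc _ w12 colA colB).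
by rewrite eq_sym.
Qed.

(** [B] and the diagonal point on [A B] share the x-coordinate of [A]; the other two diagonal points
    follow from [circle_closed]. The circle stays universally quantified because [kappa] depends on
    the target unital. *)
Lemma onan_special_circle A B C D :
    onan U A B C D -> (T <= line A B)%MS ->
  exists c y1 x1 w1 x2 w2,
    [/\ A = point c y1 1, C = point x1 w1 1, D = point x2 w2 1,
        (x1 - c) * s (x2 - c) != (x2 - c) * s (x1 - c)
      & forall P, P \in onan_points A B C D -> exists x y,
          P = point x y 1 /\ forall kappa mu nu, s kappa = - kappa ->
            circle s kappa mu nu c -> circle s kappa mu nu x1 ->
            circle s kappa mu nu x2 -> circle s kappa mu nu x].
Proof.
move=> oU TAB.
have AT := onan_vertex_neq_T oU.
have BT := onan_vertex_neq_T (onan_swap12 oU).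
have CT := onan_vertex_neq_T (onan_swap12 (onan_swap23 oU)).
have DT := onan_vertex_neq_T (onan_swap12 (onan_swap23 (onan_swap34 oU))).
have ET := onan_diagonal_neq_T oU.
have GT := onan_diagonal_neq_T (onan_swap23 oU).
have HT := onan_diagonal_neq_T (onan_swap23 (onan_swap34 oU)).
case/and5P: oU => UA UB UC UD /and4P[/and4P[n1 n2 n3 n4] UE UG UH].
have [c [y1 [EA on0]]] := unital_affine UA AT.
have [x0 [y2 [EB on1]]] := unital_affine UB BT.
have [x1 [w1 [EC on2]]] := unital_affine UC CT.
have [x2 [w2 [ED on3]]] := unital_affine UD DT.
have [x3 [y3 [EE onE]]] := unital_affine UE ET.
have [x4 [w4 [EG onG]]] := unital_affine UG GT.
have [x5 [w5 [EH onH]]] := unital_affine UH HT.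
have := meet_left (line A B) (line C D); rewrite EE => EAB.
have := meet_right (line A B) (line C D); rewrite EE => ECD.
have := meet_left (line A C) (line B D); rewrite EG => GAC.
have := meet_right (line A C) (line B D); rewrite EG => GBD.
have := meet_left (line A D) (line B C); rewrite EH => HAD.
have := meet_right (line A D) (line B C); rewrite EH => HBC.
rewrite /onan_points EE EG EH; subst A B C D.
have c0 := T_on_line TAB; subst x0.
rewrite !noncollinear_affine !subrr !mul0r in n1 n2 n3.
rewrite eq_sym mulf_eq0 negb_or !subr_eq0 in n1; case/andP: n1 => x1c y21.
rewrite eq_sym mulf_eq0 negb_or !subr_eq0 y21 andbT in n2.
have x3c : x3 = c.
  apply/eqP; rewrite -subr_eq0 -(inj_eq (mulIf (_ : y2 - y1 != 0))) ?subr_eq0 //.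
  rewrite mul0r -oppr_eq0 -(point_on_line_det3 EAB) /det3.
  by apply/eqP; ring.
subst x3.
have colE : det3 c y3 1 x1 w1 1 x2 w2 1 = 0.
  by rewrite -(point_on_line_det3 ECD) /det3; ring.
have x12 : x1 != x2.
  apply: contraNneq n3 => x12; subst x2; apply/eqP; congr (_ * (_ - _)).
  apply: (mulfI (_ : x1 - c != 0)); first by rewrite subr_eq0.
  apply/eqP; rewrite -subr_eq0 -colE /det3; apply/eqP; ring.
(* The diagonal point on [A B] is a third unital point of the line [C D], to which the arc property
   applies. *)
have ind := on_unital_arc anis onE on2 on3 colE x1c n2 x12.
have sr := on_unital_vertical on1 on0; have sp := on_unital_vertical onE on0.
exists c, y1, x1, w1, x2, w2; split=> // P; rewrite !inE.
have r0 : y2 - y1 != 0 by rewrite subr_eq0.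
have u0 : x1 - c != 0 by rewrite subr_eq0.
have v0 : x2 - c != 0 by rewrite subr_eq0.
case/or4P=> [||| /or4P[]] /eqP->.
- by exists c, y1; split.
- by exists c, y2; split.
- by exists x1, w1; split.
- by exists x2, w2; split.
- by exists c, y3; split.
- exists x4, w4; split=> // kappa mu nu skappa; rewrite -(subrKC c x1).
  rewrite -(subrKC c x2) -(subrKC c x4).
  apply: (circle_closed sK skappa sp sr r0 u0 v0).
  apply: (collinear_vertices_circle (w3 := w4) colE);
    exact: point_on_line_det3.
(* The last diagonal point arises from the previous one by exchanging [C] and [D]. *)
- exists x5, w5; split=> // kappa mu nu skappa + c1 c2; move: c2 c1.
  rewrite -(subrKC c x1) -(subrKC c x2) -(subrKC c x5).
  move=> c2 c1 c0.
  apply: (circle_closed sK skappa sp sr r0 v0 u0 _ c0 c2 c1).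
  apply: (@collinear_vertices_circle _ c y1 y2 y3 x2 w2 x1 w1 x5 w5);
    try exact: point_on_line_det3.
  by rewrite -[RHS]oppr0 -colE /det3; ring.
Qed.

End Config.
End Unital.

(** * Collineations *)

Section Collineation.

Variables (F : finFieldType) (M : 'M[F]_3).
Hypothesis uM : M \in unitmx.
Implicit Types (P Q R A B C D L : 'M[F]_3) (U : {set 'M[F]_3}).

Definition collineation P : 'M[F]_3 := <<P *m M>>%MS.

Local Notation g := collineation.

Let freeM : row_free M. Proof. by rewrite row_free_unit. Qed.

Lemma collineation_sub P L : (g P <= g L)%MS = (P <= L)%MS.
Proof. by rewrite /g !genmxE submxMfree. Qed.

(** The map sees only row spaces, so injectivity holds among canonical matrices. *)
Lemma collineation_inj P L : <<P>>%MS = P -> <<L>>%MS = L -> g P = g L -> P = L.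
Proof.
move=> P1 L1 e; rewrite -P1 -L1; apply/genmxP.
by rewrite -[(P <= L)%MS]collineation_sub -[(L <= P)%MS]collineation_sub e submx_refl.
Qed.

Lemma collineation_line P Q : g (line P Q) = line (g P) (g Q).
Proof.
apply/genmxP/eqmxP/(eqmx_trans (eqmxMr M (genmxE _))).
apply: (eqmx_trans (addsmxMr P Q M)).
by apply/eqmx_sym/adds_eqmx; apply: genmxE.
Qed.

Lemma collineation_meet L K : g (meet L K) = meet (g L) (g K).
Proof.
apply/genmxP/eqmxP/(eqmx_trans (eqmxMr M (genmxE _)))/eqmx_sym.
apply: (eqmx_trans (cap_eqmx (genmxE _) (genmxE _))).
apply/eqmxP; rewrite capmxMr andbT.
(* For the remaining inclusion, the intersection of the images is pulled back along the inverse of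
   [M]. *)
rewrite -[X in (X <= _)%MS](mulmxKV uM) submxMfree // sub_capmx.
rewrite -(submxMfree _ L freeM) -(submxMfree _ K freeM) mulmxKV //.
by rewrite capmxSl capmxSr.
Qed.

Lemma collineation_noncollinear P Q R :
  noncollinear (g P) (g Q) (g R) = noncollinear P Q R.
Proof.
rewrite /noncollinear -[in RHS](mxrankMfree _ freeM); congr (_ == _).
apply: eqmx_rank; apply/eqmxP/eqmx_sym.
apply: (eqmx_trans (addsmxMr _ _ _)); apply: adds_eqmx; last exact/eqmx_sym/genmxE.
apply: (eqmx_trans (addsmxMr _ _ _)).
by apply: adds_eqmx; apply/eqmx_sym/genmxE.
Qed.

Lemma collineation_six_lines A B C D :
  g @: six_lines A B C D = six_lines (g A) (g B) (g C) (g D).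
Proof. by rewrite /six_lines !imsetU !imset_set1 !collineation_line. Qed.

(** Membership of images is asked at the seven points only, since the collineation need not map all
    of [U] into [U']. *)
Lemma collineation_onan U U' A B C D :
    onan U A B C D -> (forall P, P \in onan_points A B C D -> P \in U -> g P \in U') ->
  onan U' (g A) (g B) (g C) (g D).
Proof.
case/and5P=> UA UB UC UD /and4P[q UE UG UH] gU.
rewrite /onan /quadrangle !collineation_noncollinear.
rewrite -!collineation_line -!collineation_meet.
have [[gA gB gC gD] [gE gG gH]] := forall_onan_points gU.
by apply/and5P; split; auto; apply/and4P; split; auto.
Qed.

(* This recovers the seven points of a Triple O'Nan from its set of lines,
   without a labelling of the quadrangle. *)
Definition is_double (S : {set 'M[F]_3}) P : bool :=
  [exists L in S, exists K in S, [&& L != K, (P <= L)%MS & (P <= K)%MS]].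

Lemma is_double_collineation (S : {set 'M[F]_3}) P :
    (forall L, L \in S -> <<L>>%MS = L) ->
  is_double (g @: S) (g P) = is_double S P.
Proof.
move=> S1; apply/exists_inP/exists_inP=> [[gL /imsetP[L SL ->]] | [L SL]].
  case/exists_inP=> gK /imsetP[K SK ->]; rewrite !collineation_sub => /and3P[LK PL PK].
  exists L => //; apply/exists_inP; exists K => //; rewrite PL PK !andbT.
  by apply: contraNneq LK => ->.
case/exists_inP=> K SK /and3P[LK PL PK]; exists (g L); first exact: imset_f.
apply/exists_inP; exists (g K); first exact: imset_f.
rewrite !collineation_sub PL PK !andbT; apply: contraNneq LK => gLK.
by apply/eqP/collineation_inj; rewrite ?S1.
Qed.

Lemma collineation_imset_inj (S S' : {set 'M[F]_3}) :
    (forall L, L \in S -> <<L>>%MS = L) -> (forall L, L \in S' -> <<L>>%MS = L) ->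
  g @: S = g @: S' -> S = S'.
Proof.
have sub (X Y : {set 'M[F]_3}) :
    (forall L, L \in X -> <<L>>%MS = L) -> (forall L, L \in Y -> <<L>>%MS = L) ->
    g @: X = g @: Y -> X \subset Y.
  move=> X1 Y1 e; apply/subsetP=> L XL.
  have: g L \in g @: Y by rewrite -e imset_f.
  by case/imsetP=> K YK /(collineation_inj (X1 _ XL) (Y1 _ YK)) ->.
by move=> S1 S1' e; apply/eqP; rewrite eqEsubset !sub.
Qed.

End Collineation.

(** * Double points of the six lines are the seven configuration points *)

Section Doubles.

Variable F : finFieldType.
Implicit Types (P Q R A B C D L : 'M[F]_3) (U : {set 'M[F]_3}).

Lemma six_lines_id A B C D L : L \in six_lines A B C D -> <<L>>%MS = L.
Proof. by rewrite !inE -!orbA => /or4P[|||/or3P[]] /eqP->; apply: line_id. Qed.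

Lemma vertices_double A B C D :
    (\rank A <= 1)%N -> (\rank B <= 1)%N -> (\rank C <= 1)%N -> (\rank D <= 1)%N ->
    quadrangle A B C D ->
  [/\ is_double (six_lines A B C D) A, is_double (six_lines A B C D) C
    & is_double (six_lines A B C D) D].
Proof.
move=> rA rB rC rD /and4P[n1 n2 n3 n4]; split; apply/exists_inP.
- exists (line A B); first by rewrite !inE eqxx ?orbT.
  apply/exists_inP; exists (line A C); first by rewrite !inE eqxx ?orbT.
  by rewrite !line_left noncollinear_line_neq.
- exists (line A C); first by rewrite !inE eqxx ?orbT.
  apply/exists_inP; exists (line C D); first by rewrite !inE eqxx ?orbT.
  rewrite line_left line_right [line A C]lineC noncollinear_line_neq //.
  by rewrite noncollinearC12.
- exists (line A D); first by rewrite !inE eqxx ?orbT.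
  apply/exists_inP; exists (line C D); first by rewrite !inE eqxx ?orbT.
  rewrite !line_right [line A D]lineC [line C D]lineC noncollinear_line_neq //.
  by rewrite noncollinearC12 noncollinearC23.
Qed.

(** Any two distinct lines among the six share one of the seven listed points, and by
    [lines_meet_unique] no other point. *)
Lemma double_onan_points A B C D P :
    (forall Q, Q \in onan_points A B C D -> <<Q>>%MS = Q /\ \rank Q = 1%N) ->
    <<P>>%MS = P -> \rank P = 1%N ->
    is_double (six_lines A B C D) P ->
  P \in onan_points A B C D.
Proof.
move=> pts P1 rP; have rL X Y : X \in onan_points A B C D ->
    Y \in onan_points A B C D -> (\rank (line X Y) <= 2)%N.
  by move=> /pts[_ rX] /pts[_ rY]; rewrite mxrank_line_point ?rX ?rY.
have [[oA oB oC oD] [oE oG oH]] :=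
  forall_onan_points (fun Q (o : Q \in onan_points A B C D) => o).
have rS L : L \in six_lines A B C D -> (\rank L <= 2)%N.
  by rewrite !inE -!orbA => /or4P[|||/or3P[]] /eqP->; rewrite rL.
case/exists_inP=> L SL /exists_inP[K SK /and3P[LK PL PK]].
have fin Q : Q \in onan_points A B C D -> (Q <= L)%MS -> (Q <= K)%MS ->
    P \in onan_points A B C D.
  move=> oQ QL QK; have [Q1 rQ] := pts _ oQ.
  by rewrite (lines_meet_unique P1 Q1 (six_lines_id SL) (six_lines_id SK) _ _
                                (rS _ SL) (rS _ SK) LK).
have {fin oA oB oC oD oE oG oH} := (fin _ oA, fin _ oB, fin _ oC, fin _ oD,
  (fin _ oE, fin _ oG, fin _ oH)).
move: (P \in onan_points A B C D) LK => isP LK fin.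
rewrite !inE -!orbA in SL SK; move: SL SK LK fin.
have := (line_left A B, line_right A B, meet_left (line A B) (line C D)).
have := (line_left C D, line_right C D, meet_right (line A B) (line C D)).
have := (line_left A C, line_right A C, meet_left (line A C) (line B D)).
have := (line_left B D, line_right B D, meet_right (line A C) (line B D)).
have := (line_left A D, line_right A D, meet_left (line A D) (line B C)).
have := (line_left B C, line_right B C, meet_right (line A D) (line B C)).
clear.
(* Only the incidences matter from here; with points and lines abstracted, the 36 pairs of lines are
   checked one by one. *)
move: (meet _ _) (meet _ _) (meet _ _) => H G E.
move: (line _ _) (line _ _) (line _ _) (line _ _) (line _ _) (line _ _).
move=> BC AD BD AC CD AB.
move=> [[? ?] ?] [[? ?] ?] [[? ?] ?] [[? ?] ?] [[? ?] ?] [[? ?] ?].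
do 2! [case/or4P=> [|||/or3P[]] /eqP->];
  rewrite ?eqxx // => _ [[[[fA fB] fC] fD] [[fE fG] fH]]; auto.
Qed.

End Doubles.

(** * The collineations [(x, y) |-> (t * x, y + mu * x + nu)] *)

Section Shear.

Variables (F : finFieldType) (t : F).
Hypothesis t_neq0 : t != 0.
Implicit Types (mu nu : F) (P : 'M[F]_3).

Definition shear_mx mu nu : 'M[F]_3 :=
  \matrix_i [:: vec t mu 0; vec 0 1 0; vec 0 nu 1]`_i.

Definition shear mu nu P : 'M[F]_3 := collineation (shear_mx mu nu) P.

Lemma shear_mx_unit mu nu : shear_mx mu nu \in unitmx.
Proof.
rewrite unitmxE unitfE det_mx33 !mxE /= /det3.
by rewrite !(mul0r, mulr0, subr0, addr0, mul1r, mulr1).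
Qed.

Lemma shear_point mu nu x y z :
  shear mu nu (point x y z) = point (t * x) (mu * x + y + nu * z) z.
Proof.
rewrite /shear /collineation /point; apply/genmxP/eqmxP.
apply: (eqmx_trans (eqmxMr _ (genmxE _))).
rewrite -[X in (X *m _)%R]/(vec x y z) vec_mul !rowK /=.
rewrite (_ : _ + _ = vec (t * x) (mu * x + y + nu * z) z) //.
by apply/rowP; apply: forall_ord3; rewrite !mxE /=; ring.
Qed.

Lemma shear_T mu nu : shear mu nu (T_infty F) = T_infty F.
Proof. by rewrite shear_point !mulr0 !add0r addr0. Qed.

End Shear.

(** * Injection of special configurations between unitals *)

Section Injection.

Variables (F : finFieldType) (q : nat) (s : {rmorphism F -> F}).
Hypotheses (sK : involutive s) (sE : forall x, s x = x ^+ q).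
Hypothesis two_neq0 : 2%:R != 0 :> F.

Local Notation T := (T_infty F).

Variables (a b b' t : F).
Hypotheses (t_neq0 : t != 0) (anis : anisotropic s a b).
Let a' := a / t ^+ 2.
(* Chosen so that Q'(t * x) = Q(x) + kappa * x ^+ q.+1 for the forms Q, Q' of the
   two unitals. *)
Let kappa := im s b' * (t * s t) - im s b.

Local Notation U := (bm_unital q a b).
Local Notation U' := (bm_unital q a' b').

Lemma s_kappa : s kappa = - kappa.
Proof.
by rewrite /kappa rmorphB !rmorphM !(s_im sK) sK; ring.
Qed.

(** On the circle, the added term [im (mu * x + nu)] is exactly the difference of the two forms. *)
Lemma on_unital_shear mu nu x y :
    circle s kappa mu nu x -> on_unital s a b x y ->
  on_unital s a' b' (t * x) (mu * x + y + nu).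
Proof.
rewrite /on_unital /circle => circ onP.
have -> : mu * x + y + nu = (mu * x + nu) + y by ring.
rewrite imD circ onP /bmform /kappa.
have -> : a' * (t * x) ^+ 2 = a * x ^+ 2 by rewrite /a'; field.
by rewrite (rmorphM s t); ring.
Qed.

(** Phrased through double points, so that the shear parameters depend on the set of lines and not
    on a labelling. *)
Definition admissible (S : {set 'M[F]_3}) (m : F * F) : bool :=
  (s m.2 == - m.2) &&
  [forall x, forall y, is_double S (point x y 1) ==>
     (im s (m.1 * x + m.2) == kappa * (x * s x))].

Lemma admissibleP S m :
  reflect (s m.2 = - m.2 /\ forall x y, is_double S (point x y 1) ->
             circle s kappa m.1 m.2 x)
          (admissible S m).
Proof.
apply: (iffP andP) => -[/eqP sm H]; split; rewrite ?sm //.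
  by move=> x y; move: H => /forallP/(_ x)/forallP/(_ y)/implyP H /H/eqP.
by apply/forallP=> x; apply/forallP=> y; apply/implyP=> /H/eqP.
Qed.

Lemma special_double_points S :
    S \in special_triple_onans U ->
  exists c y x1 y1 x2 y2,
    [/\ is_double S (point c y 1), is_double S (point x1 y1 1),
        is_double S (point x2 y2 1)
      & (x1 - c) * s (x2 - c) != (x2 - c) * s (x1 - c)].
Proof.
case/special_triple_onanP=> A [B [C [D [oU -> TAB]]]].
have [c [y1 [x1 [w1 [x2 [w2 [EA EC ED ind _]]]]]]] :=
  onan_special_circle sK sE anis oU TAB.
exists c, y1, x1, w1, x2, w2; rewrite -EA -EC -ED.
case/and5P: oU => UA UB UC UD /and4P[quad _ _ _].
have rk := mxrank_unital sK sE.
by have [] := @vertices_double F A B C D; rewrite ?(rk a b).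
Qed.

(** The circle through the x-coordinates of [A], [C], [D] contains those of all seven points, hence
    of all double points. *)
Lemma special_admissible S :
  S \in special_triple_onans U -> exists m, admissible S m.
Proof.
case/special_triple_onanP=> A [B [C [D [oU -> TAB]]]].
have [c [y1 [x1 [w1 [x2 [w2 [EA EC ED ind pts]]]]]]] :=
  onan_special_circle sK sE anis oU TAB.
have [mu [nu [snu c0 c1 c2]]] := circle_through sK two_neq0 s_kappa ind.
exists (mu, nu); apply/admissibleP; split=> // x y dbl.
have /pts[x' [y' [/point_affine_inj[-> _] circ]]] :
    point x y 1 \in onan_points A B C D.
  apply: double_onan_points dbl; last exact: mxrank_affine_point; last exact: point_id.
  move=> Q /(onan_points_sub oU) UQ.
  by rewrite (genmx_unital sK sE UQ) (mxrank_unital sK sE UQ).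
by apply: circ => //; exact: s_kappa.
Qed.

Lemma admissible_image S m :
    S \in special_triple_onans U -> admissible S m ->
  shear t m.1 m.2 @: S \in special_triple_onans U'.
Proof.
case/special_triple_onanP=> A [B [C [D [oU SE TAB]]]] /admissibleP[sm circ].
have [c [y1 [x1 [w1 [x2 [w2 [EA EC ED ind pts]]]]]]] :=
  onan_special_circle sK sE anis oU TAB.
have uM := shear_mx_unit t_neq0 m.1 m.2.
have [dA dC dD] : [/\ is_double S A, is_double S C & is_double S D].
  case/and5P: oU => UA UB UC UD /and4P[quad _ _ _]; rewrite SE.
  have rk := mxrank_unital sK sE.
  by have [] := @vertices_double F A B C D; rewrite ?(rk a b).
rewrite EA in dA; rewrite EC in dC; rewrite ED in dD.
have oU' : onan U' (shear t m.1 m.2 A) (shear t m.1 m.2 B)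
                   (shear t m.1 m.2 C) (shear t m.1 m.2 D).
  apply: (collineation_onan uM oU) => P /pts[x [y [-> circ_x]]].
  move/(affine_in_unital sK sE) => onP.
  rewrite -[collineation _ _]/(shear t m.1 m.2 _) shear_point mulr1.
  apply/(affine_in_unital sK sE)/on_unital_shear => //.
  by apply: circ_x; [exact: s_kappa | exact: circ dA | exact: circ dC | exact: circ dD].
have SE' : shear t m.1 m.2 @: S = six_lines (shear t m.1 m.2 A)
    (shear t m.1 m.2 B) (shear t m.1 m.2 C) (shear t m.1 m.2 D).
  by rewrite SE; exact: collineation_six_lines.
rewrite inE; apply/andP; split.
  by apply/triple_onanP; do 4 eexists; split; first exact: oU'.
apply/exists_inP; exists (shear t m.1 m.2 (line A B)).
  by apply: imset_f; rewrite SE !inE eqxx.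
by rewrite -(shear_T t m.1 m.2) /shear collineation_sub.
Qed.

Lemma special_lines_id S L :
  S \in special_triple_onans U -> L \in S -> <<L>>%MS = L.
Proof.
by case/special_triple_onanP=> A [B [C [D [_ -> _]]]]; exact: six_lines_id.
Qed.

(** Both shears scale x by the same [t], so [S1] and [S2] have double points over the same
    x-coordinates. Hence both circles pass through three independent ones, [circle_unique] gives
    [m1 = m2], and a single shear is injective. *)
Lemma admissible_inj S1 S2 m1 m2 :
    S1 \in special_triple_onans U -> S2 \in special_triple_onans U ->
    admissible S1 m1 -> admissible S2 m2 ->
    shear t m1.1 m1.2 @: S1 = shear t m2.1 m2.2 @: S2 ->
  S1 = S2.
Proof.
move=> S1U S2U /admissibleP[sm1 circ1] /admissibleP[sm2 circ2] e.
have id1 L := @special_lines_id S1 L S1U; have id2 L := @special_lines_id S2 L S2U.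
have uM1 := shear_mx_unit t_neq0 m1.1 m1.2.
have uM2 := shear_mx_unit t_neq0 m2.1 m2.2.
have dbl x y : is_double S1 (point x y 1) -> circle s kappa m2.1 m2.2 x.
  rewrite -(is_double_collineation uM1) //.
  rewrite -[collineation _]/(shear t m1.1 m1.2) e shear_point => d.
  (* This height makes the second shear send the point to the image of [(x, y)] under the first. *)
  apply: (circ2 x (y + (m1.1 - m2.1) * x + (m1.2 - m2.2))).
  rewrite -(is_double_collineation uM2) //.
  rewrite -[collineation _]/(shear t m2.1 m2.2) shear_point.
  by rewrite (_ : _ + m2.2 * 1 = m1.1 * x + y + m1.2 * 1) //; ring.
have [c [y [x1 [y1 [x2 [y2 [d0 d1 d2 ind]]]]]]] := special_double_points S1U.
have [E1 E2] := circle_unique two_neq0 ind sm1 sm2 (circ1 _ _ d0) (dbl _ _ d0)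
  (circ1 _ _ d1) (dbl _ _ d1) (circ1 _ _ d2) (dbl _ _ d2).
apply: (collineation_imset_inj uM1) => //.
by rewrite -[LHS]/(shear t m1.1 m1.2 @: S1) e E1 E2.
Qed.

Lemma leq_card_special_triple_onans :
  (#|special_triple_onans U| <= #|special_triple_onans U'|)%N.
Proof.
(* The fallback [S] is never returned on a special configuration, by [special_admissible]. *)
pose f S := if [pick m | admissible S m] is Some m
            then shear t m.1 m.2 @: S else S.
have fP S : S \in special_triple_onans U -> exists2 m, admissible S m
    & f S = shear t m.1 m.2 @: S.
  move=> SU; rewrite /f; case: pickP => [m adm|none]; first by exists m.
  by have [m] := special_admissible SU; rewrite none.
rewrite -(card_in_imset (f := f)).
  apply/subset_leq_card/subsetP=> S' /imsetP[S SU ->].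
  by have [m adm ->] := fP S SU; exact: admissible_image.
move=> S1 S2 S1U S2U.
have [m1 adm1 ->] := fP S1 S1U; have [m2 adm2 ->] := fP S2 S2U.
exact: admissible_inj.
Qed.

End Injection.

(** * The classical case *)

Lemma point_scale (F : finFieldType) (k x y z : F) :
  k != 0 -> point (k * x) (k * y) (k * z) = point x y z.
Proof.
move=> k0; apply/genmxP/eqmxP.
rewrite (_ : (\row_j _) = k *: vec x y z); first exact: eqmx_scale.
by apply/rowP; apply: forall_ord3; rewrite !mxE.
Qed.

Section Classical.

Variables (F : finFieldType) (q : nat) (s : {rmorphism F -> F}).
Hypotheses (sK : involutive s) (sE : forall x, s x = x ^+ q).
Variable b : F.
Hypothesis im_b : im s b != 0.

(** The homogenised unital equation for [a = 0] is skew-Hermitian; multiplying it by [im s b], which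
    [s] negates, makes it Hermitian. *)
Definition hermitian_mx : 'M[F]_3 :=
  \matrix_i [:: vec (- im s b ^+ 2) 0 0; vec 0 0 (im s b);
                vec 0 (- im s b) 0]`_i.

Lemma hermitian_mxE x y z :
  (vec x y z *m hermitian_mx *m (conj_mx q (vec x y z))^T == 0)
    = (y * s z - z * s y == im s b * (x * s x)).
Proof.
have -> : vec x y z *m hermitian_mx
    = vec (- im s b ^+ 2 * x) (- im s b * z) (im s b * y).
  rewrite vec_mul !rowK /=; apply/rowP.
  by apply: forall_ord3; rewrite !mxE /=; ring.
transitivity (im s b * (y * s z - z * s y - im s b * (x * s x)) == 0); last first.
  by rewrite mulf_eq0 (negPf im_b) subr_eq0.
have -> : im s b * (y * s z - z * s y - im s b * (x * s x)) =
  (vec (- im s b ^+ 2 * x) (- im s b * z) (im s b * y)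
      *m (conj_mx q (vec x y z))^T) 0 0.
  by rewrite !mxE !big_ord_recl big_ord0 !mxE /= -!sE; ring.
apply/eqP/eqP=> [-> | e]; first by rewrite mxE.
by apply/matrixP=> i j; rewrite !ord1 e mxE.
Qed.

Lemma bm_unital0_classical : classical q (bm_unital q 0 b).
Proof.
exists hermitian_mx; split.
- rewrite unitmxE unitfE det_mx33 !mxE /= /det3.
  have -> : forall r : F, - r ^+ 2 * (0 * 0 - - r * r) - 0 * (0 * 0 - 0 * r) +
    0 * (0 * - r - 0 * 0) = - r ^+ 4 by move=> r; ring.
  by rewrite oppr_eq0 expf_neq0.
- apply/matrixP=> i j; rewrite [RHS]mxE -sE; move: i j.
  apply: forall_ord3; apply: forall_ord3; rewrite !mxE /= ?rmorph0 //.
  + by rewrite rmorphN rmorphXn /= s_im // sqrrN.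
  + by rewrite s_im.
  + by rewrite rmorphN /= s_im // opprK.
apply/setP=> P; apply/(bm_unitalP sK sE)/imsetP.
- case=> [-> | [x [y [-> onP]]]].
    exists (vec 0 1 0) => //; rewrite inE hermitian_mxE !rmorph0 !(mulr0, mul0r).
    rewrite subrr eqxx andbT; apply/eqP=> /rowP/(_ 1); rewrite !mxE /= => /eqP.
    by rewrite oner_eq0.
  exists (vec x y 1) => //; rewrite inE hermitian_mxE rmorph1 mulr1 mul1r.
  rewrite -[y - s y]/(im s y) onP /bmform mul0r (im_fixed (rmorph0 s)) add0r eqxx.
  rewrite andbT; apply/eqP=> /rowP/(_ 2%:R); rewrite !mxE /= => /eqP.
  by rewrite oner_eq0.
case=> v; rewrite inE [v]rowE_vec.
move: (v 0 0) (v 0 1) (v 0 2%:R) => x y z; rewrite hermitian_mxE.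
(* On the line [z = 0] the equation forces [x = 0], which leaves [T_infty]; elsewhere dividing by
   [z * s z] gives the affine equation. *)
have [-> | z0] := eqVneq z 0 => /andP[v0 /eqP e] ->.
  left; have /eqP : im s b * (x * s x) = 0 by rewrite -e rmorph0 mulr0 mul0r subrr.
  rewrite !mulf_eq0 (negPf im_b) /= fmorph_eq0 orbb => /eqP x0; subst x.
  have y0 : y != 0.
    apply: contraNneq v0 => ->; apply/eqP/rowP.
    by apply: forall_ord3; rewrite !mxE.
  by rewrite -[RHS](point_scale _ _ _ y0) mulr1 mulr0.
right; exists (x / z), (y / z); split.
  by rewrite -[RHS](point_scale _ _ _ z0) mulr1 ![z * _]mulrC !divfK.
have sz0 : s z != 0 by rewrite fmorph_eq0.
rewrite /on_unital /bmform mul0r (im_fixed (rmorph0 s)) add0r.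
rewrite {1}/im !fmorph_div.
apply: (mulIf (mulf_neq0 z0 sz0)).
transitivity (y * s z - z * s y); first by field; rewrite z0 sz0.
by rewrite e; field; rewrite z0 sz0.
Qed.

End Classical.

Unset Implicit Arguments.

Theorem theorem5 (F : finFieldType) (q : nat) (a b a' b' : F)
    (q_odd : odd q) (cardF : #|F| = (q ^ 2)%N)
    (d_nonsquare : nonsquare_in (Fq F q) (bm_disc q a b))
    (d'_nonsquare : nonsquare_in (Fq F q) (bm_disc q a' b'))
    (U_nonclassical : ~ classical q (bm_unital q a b))
    (U'_nonclassical : ~ classical q (bm_unital q a' b'))
    (same_type : square_in [set: F] a = square_in [set: F] a') :
  #|special_triple_onans (bm_unital q a b)|
    = #|special_triple_onans (bm_unital q a' b')|.
Proof.
have [s sK sE] := finField_sqrt_rmorphism cardF.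
have two_neq0 : 2%:R != 0 :> F.
  by apply: finField_odd_two_neq0; rewrite cardF oddX q_odd.
have anis := nonsquare_disc_anisotropic sK sE d_nonsquare.
have anis' := nonsquare_disc_anisotropic sK sE d'_nonsquare.
(* If [c = 0], anisotropy at 1 gives [im s d != 0], so the unital is a nondegenerate Hermitian
   curve. *)
have nonclassical_neq0 c d : anisotropic s c d ->
    ~ classical q (bm_unital q c d) -> c != 0.
  move=> an; apply: contra_notN => /eqP c0; rewrite {}c0 in an *.
  apply: (bm_unital0_classical sK sE); apply/eqP => im0.
  case/eqP: (oner_neq0 F); apply: an.
  by rewrite /bmform im0 !mul0r (im_fixed (rmorph0 s)) addr0.
have a_neq0 := nonclassical_neq0 _ _ anis U_nonclassical.
have a'_neq0 := nonclassical_neq0 _ _ anis' U'_nonclassical.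
have [c c_neq0 a'E] := square_quotient same_type a_neq0 a'_neq0.
(* From [a' = a * c ^+ 2], the two inequalities use the scalings [t = c^-1] and [t = c]. *)
apply/eqP; rewrite eqn_leq; apply/andP; split.
- have -> : a' = a / c^-1 ^+ 2 by rewrite exprVn invrK.
  by apply: (leq_card_special_triple_onans sK sE two_neq0); rewrite ?invr_eq0.
have -> : a = a' / c ^+ 2 by rewrite a'E mulfK ?expf_neq0.
exact: (leq_card_special_triple_onans sK sE two_neq0).
Qed.
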